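(* Let $\epsilon<0.501$. Then there do not exist maps $f_r,f_c$ (where $f_r$ maps each row player's payoff matrix $R\in[0,1]^{n\times n}$ to a mixed strategy over rows and $f_c$ maps each column player's payoff matrix $C\in[0,1]^{n\times n}$ to a mixed strategy over columns, for every $n$) such that for every $n$ and every bimatrix game $(R,C)$ with $R,C\in[0,1]^{n\times n}$ the profile $(f_r(R),f_c(C))$ is an $\epsilon$-approximate Nash equilibrium. That is, if each player independently computes a mixed strategy from his own payoff matrix, an $\epsilon$-approximate Nash equilibrium cannot be guaranteed for $\epsilon<0.501$.
   Context: A bimatrix game $(R,C)$ has $n\times n$ payoff matrices with entries in $[0,1]$ for the row and column player. For mixed strategies $\mathbf{x},\mathbf{y}$ the payoffs are $\mathbf{x}^TR\mathbf{y}$ and $\mathbf{x}^TC\mathbf{y}$. $(\mathbf{x},\mathbf{y})$ is an $\epsilon$-approximate Nash equilibrium if for all pure strategies $i$: $\mathbf{e}_i^TR\mathbf{y}\le\mathbf{x}^TR\mathbf{y}+\epsilon$ and $\mathbf{x}^TC\mathbf{e}_i\le\mathbf{x}^TC\mathbf{y}+\epsilon$, where $\mathbf{e}_i$ is the $i$-th unit vector. *)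

(* Defs.v *)
From HB Require Import structures.
From mathcomp Require Import all_boot all_order all_algebra.
From mathcomp Require Import reals.
Set Implicit Arguments. Unset Strict Implicit. Unset Printing Implicit Defensive.
Import Order.TTheory GRing.Theory Num.Theory.
Local Open Scope ring_scope.

Definition unit_matrix (R : realType) (n : nat) (A : 'M[R]_n) : Prop :=
  forall i j, 0 <= A i j <= 1.

Definition mixed (R : realType) (n : nat) (x : 'cV[R]_n) : Prop :=
  (forall i, 0 <= x i 0) /\ \sum_i x i 0 = 1.

Definition payoff (R : realType) (n : nat) (x : 'cV[R]_n) (A : 'M[R]_n)
  (y : 'cV[R]_n) : R := (x^T *m A *m y) 0 0.

Definition unitv (R : realType) (n : nat) (i : 'I_n) : 'cV[R]_n := delta_mx i 0.

Definition approx_NE (R : realType) (n : nat) (Rm C : 'M[R]_n)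
  (x y : 'cV[R]_n) (eps : R) : Prop :=
  forall i : 'I_n,
    payoff (unitv R i) Rm y <= payoff x Rm y + eps /\
    payoff x C (unitv R i) <= payoff x C y + eps.

(* Main.v *)
(* Let y^j be the column player's answer to the matrix whose column j is all
   ones and whose other columns vanish; then y^j_j >= 1 - eps. In a large game
   there is a fixed-size set J of columns such that y^j puts almost no mass on
   J \ {j} for j in J. Consider a row matrix R^t supported on a block S_t of
   rows indexed by J, whose row j is 1 on column j and outside J. Since the
   column player might win exactly when the row lies in S_t, and cannot know
   which of many disjoint blocks is used, the answer x^t to R^t puts mass at
   most eps + o(1) on S_t for some t. Against y^j, row j of S_t then earns
   1 - o(1), whereas x^t earns at most
   x^t(S_t) (1 - y^j_j) + o(1) <= eps^2 + o(1). Hence 1 - eps^2 <= eps, which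
   even gives eps >= (sqrt 5 - 1) / 2. *)
Require Import Defs.
From HB Require Import structures.
From mathcomp Require Import all_boot all_order all_algebra.
From mathcomp Require Import reals.
From mathcomp Require Import zify lra.
Import Order.TTheory GRing.Theory Num.Theory.
Local Open Scope ring_scope.

(** * Averaging and sparse subsets *)

Lemma exists_le_average (R : realFieldType) (T : finType) (V : {set T})
    (F : T -> R) (c : R) :
  (0 < #|V|)%N -> \sum_(i in V) F i <= c *+ #|V| ->
  exists2 i, i \in V & F i <= c.
Proof.
move=> V0 leF; case: (boolP [exists i in V, F i <= c]) => [/exists_inP//|].
move=> /exists_inPn nF; suff : c *+ #|V| < \sum_(i in V) F i by rewrite ltNge leF.
rewrite -sumr_const; apply: ltr_sum => [|i iV]; last by rewrite ltNge nF.
by case/card_gt0P: V0 => i iV; apply/hasP; exists i; rewrite ?mem_index_enum.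
Qed.

Lemma sum_subset_le (R : realFieldType) (T : finType) (P Q : pred T) (F : T -> R) :
  (forall i, 0 <= F i) -> (forall i, P i -> Q i) ->
  \sum_(i | P i) F i <= \sum_(i | Q i) F i.
Proof.
move=> F0 PQ; rewrite [leRHS](bigID P) /= (eq_bigl P) => [|i].
  by rewrite lerDl sumr_ge0.
by case: (boolP (P i)) => [/PQ->|]; rewrite ?andbF.
Qed.

(** Markov's inequality in counting form: more than [D] values above 1/D would sum to more than
    1. *)
Lemma card_large_values (R : realFieldType) (T : finType) (V : {set T})
    (F : T -> R) (D : nat) :
  (0 < D)%N -> (forall i, 0 <= F i) -> \sum_(i in V) F i <= 1 ->
  (#|[set i in V | (D%:R^-1 < F i)%R]| <= D)%N.
Proof.
move=> D0 F0 F1; set S := [set _ in _ | _].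
have DR : 0 < D%:R :> R by rewrite ltr0n.
rewrite -(ler_nat R) -[leRHS]mul1r -ler_pdivrMr //.
apply: le_trans F1; rewrite mulr_natl -sumr_const.
apply: (@le_trans _ _ (\sum_(i in S) F i)).
  by apply: ler_sum => i; rewrite inE => /andP[_ /ltW].
by apply: sum_subset_le => // i; rewrite inE => /andP[].
Qed.

(* Greedy choice: some v in V receives total weight at most 1 from V, and
   discarding the at most 2 D points joined to v by a large entry costs
   2 D + 1 points per step. *)
Lemma sparse_subset (R : realFieldType) (T : finType) (A : T -> T -> R)
    (D k : nat) (V : {set T}) :
  (0 < D)%N -> (forall i j, 0 <= A i j) -> (forall i, \sum_j A i j <= 1) ->
  (k * D.*2.+1 <= #|V|)%N ->
  exists J : {set T}, [/\ J \subset V, #|J| = k &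
    {in J &, forall i j, i != j -> A i j <= D%:R^-1}].
Proof.
move=> D0 A0 A1; elim: k V => [|k IHk] V leV.
  by exists set0; split; rewrite ?sub0set ?cards0 // => i j; rewrite inE.
have [||v vV Av] := @exists_le_average R T V (fun v => \sum_(i in V) A i v) 1.
- lia.
- rewrite exchange_big /= -sumr_const; apply: ler_sum => i _.
  by apply: le_trans (A1 i); apply: sum_subset_le.
pose Sin := [set i in V | D%:R^-1 < A i v].
pose Sout := [set j in V | D%:R^-1 < A v j].
have cin : (#|Sin| <= D)%N by apply: card_large_values.
have cout : (#|Sout| <= D)%N.
  by apply: card_large_values => //; apply: le_trans (A1 v); apply: sum_subset_le.
pose W := V :\: (v |: (Sin :|: Sout)).
have cW : (k * D.*2.+1 <= #|W|)%N.
  have := cardsD V (v |: (Sin :|: Sout)); rewrite -/W.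
  have := subset_leq_card (subsetIr V (v |: (Sin :|: Sout))).
  have := cardsU1 v (Sin :|: Sout); have := cardsU Sin Sout.
  by have := leq_b1 (v \notin Sin :|: Sout); lia.
have [J [JW cJ AJ]] := IHk W cW.
have JP i : i \in J -> [/\ i \in V, i != v, A i v <= D%:R^-1 & A v i <= D%:R^-1].
  move=> /(subsetP JW); rewrite !inE !negb_or => /andP[/and3P[-> nin nout] iV].
  by move: nin nout; rewrite iV /= -!leNgt.
exists (v |: J); split.
- by apply/subsetP => i; rewrite !inE => /orP[/eqP->|/JP[]].
- by rewrite cardsU1 cJ; case: (boolP (v \in J)) => // /JP[_]; rewrite eqxx.
move=> i j; rewrite !inE => /orP[/eqP->|iJ] /orP[/eqP->|jJ].
- by rewrite eqxx.
- by case: (JP j jJ).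
- by case: (JP i iJ).
exact: AJ.
Qed.

(** * Payoffs as sums over pure strategies, and 0-1 games *)

Lemma payoff_unitl (R : realType) n (A : 'M[R]_n) (y : 'cV[R]_n) i :
  payoff (unitv R i) A y = \sum_j A i j * y j 0.
Proof.
by rewrite /payoff /unitv trmx_delta -rowE !mxE; under eq_bigr do rewrite mxE.
Qed.

Lemma payoff_unitr (R : realType) n (A : 'M[R]_n) (x : 'cV[R]_n) j :
  payoff x A (unitv R j) = \sum_i x i 0 * A i j.
Proof. by rewrite /payoff /unitv -colE !mxE; under eq_bigr do rewrite mxE. Qed.

Lemma payoffEl (R : realType) n (A : 'M[R]_n) (x y : 'cV[R]_n) :
  payoff x A y = \sum_i x i 0 * payoff (unitv R i) A y.
Proof.
rewrite /payoff -mulmxA mxE; apply: eq_bigr => i _.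
by rewrite [x^T _ _]mxE -mulmxA /unitv trmx_delta -rowE [row _ _ _ _]mxE.
Qed.

Lemma payoffEr (R : realType) n (A : 'M[R]_n) (x y : 'cV[R]_n) :
  payoff x A y = \sum_j payoff x A (unitv R j) * y j 0.
Proof.
rewrite /payoff mxE; apply: eq_bigr => j _.
by rewrite /unitv -colE [col _ _ _ _]mxE. Qed.

Lemma mixed_le1 (R : realType) n (x : 'cV[R]_n) (P : pred 'I_n) :
  mixed x -> \sum_(i | P i) x i 0 <= 1.
Proof. by case=> x0 <-; apply: sum_subset_le. Qed.

Definition bool_mx (R : realType) n (b : 'I_n -> 'I_n -> bool) : 'M[R]_n :=
  \matrix_(i, j) (b i j)%:R.

Lemma unit_bool_mx (R : realType) n b : unit_matrix (bool_mx R n b).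
Proof. by move=> i j; rewrite mxE ler0n lern1 leq_b1. Qed.

Lemma payoff_bool_unitl (R : realType) n b (y : 'cV[R]_n) i :
  payoff (unitv R i) (bool_mx R n b) y = \sum_(j | b i j) y j 0.
Proof.
rewrite payoff_unitl [RHS]big_mkcond /=; apply: eq_bigr => j _.
by rewrite mxE; case: (b i j); rewrite ?mul1r ?mul0r.
Qed.

Lemma payoff_bool_unitr (R : realType) n b (x : 'cV[R]_n) j :
  payoff x (bool_mx R n b) (unitv R j) = \sum_(i | b i j) x i 0.
Proof.
rewrite payoff_unitr [RHS]big_mkcond /=; apply: eq_bigr => i _.
by rewrite mxE; case: (b i j); rewrite ?mulr1 ?mulr0.
Qed.

Lemma dominant_column_weight (R : realType) n (x y : 'cV[R]_n) j eps :
  mixed x ->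
  payoff x (bool_mx R n (fun _ k => k == j)) (unitv R j) <=
    payoff x (bool_mx R n (fun _ k => k == j)) y + eps ->
  1 <= y j 0 + eps.
Proof.
move=> [x0 x1]; rewrite payoff_bool_unitr (eq_bigl predT) ?x1; last first.
  by move=> i; rewrite eqxx.
suff -> : payoff x (bool_mx R n (fun _ k => k == j)) y = y j 0 by [].
rewrite payoffEl; under eq_bigr do rewrite payoff_bool_unitl big_pred1_eq.
by rewrite -mulr_suml x1 mul1r.
Qed.

(** The column player guesses the row's block, within a sparse set [T] of [m] blocks. The answer
    [fc C] has weight at most 1/m on some [t] in [T], so it earns little against [X t], while pure
    column [t] earns the whole mass of [X t] on block [t]. *)
Lemma block_mass_le (R : realType) n (X : 'I_n -> 'cV[R]_n)
    (fc : 'M[R]_n -> 'cV[R]_n) (blk : 'I_n -> 'I_n) (V : {set 'I_n})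
    (m D : nat) (eps : R) :
  (0 < m)%N -> (0 < D)%N -> (m * D.*2.+1 <= #|V|)%N ->
  (forall t, mixed (X t)) ->
  (forall C, unit_matrix C -> mixed (fc C)) ->
  (forall C t j, unit_matrix C ->
     payoff (X t) C (unitv R j) <= payoff (X t) C (fc C) + eps) ->
  exists2 t, t \in V &
    \sum_(i | blk i == t) X t i 0 <= m%:R^-1 + D%:R^-1 + eps.
Proof.
move=> m0 D0 leV Xmix fcmix regret.
pose B t s := \sum_(i | blk i == s) X t i 0.
have B0 t s : 0 <= B t s by apply: sumr_ge0 => i _; case: (Xmix t).
have B1 t : \sum_s B t s = 1.
  case: (Xmix t) => _ <-; rewrite [RHS](partition_big blk predT) //=.
have [|T [TV cT smallB]] := sparse_subset _ _ B D m V D0 B0 _ leV.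
  by move=> t; rewrite B1.
pose C := bool_mx R n (fun i s => (s \in T) && (blk i == s)).
have uC : unit_matrix C by apply: unit_bool_mx.
have [y0 y1] := fcmix C uC.
have [||t tT yt] := exists_le_average R _ T (fun s => fc C s 0) m%:R^-1.
- by rewrite cT.
- rewrite cT -[leRHS]mulr_natr mulVf ?pnatr_eq0 -?lt0n //.
  exact: mixed_le1 (fcmix C uC).
exists t; first exact: (subsetP TV).
have CE s : payoff (X t) C (unitv R s) = if s \in T then B t s else 0.
  rewrite payoff_bool_unitr; case: ifP => _; first exact: eq_bigl.
  by rewrite big_pred0_eq.
have := regret C t t uC; rewrite [payoff _ _ (fc C)]payoffEr; under eq_bigr do rewrite CE.
(* The term [t] is at most [fc C t 0], since [B t t <= 1]; the other coefficients are at most 1/D by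
   sparsity of [T]. *)
rewrite CE tT (bigD1 t) //= tT => /le_trans; apply; rewrite lerD2r lerD //.
  apply: le_trans yt; rewrite ler_piMl //.
  exact: mixed_le1 (Xmix t).
apply: (@le_trans _ _ (\sum_s D%:R^-1 * fc C s 0)); last first.
  by rewrite -mulr_sumr y1 mulr1.
rewrite [leRHS](bigD1 t) //= -[leLHS]add0r lerD ?mulr_ge0 ?invr_ge0 ?ler0n //.
apply: ler_sum => s st; apply: ler_wpM2r => //.
case: ifP => sT; last by rewrite invr_ge0 ler0n.
by apply: smallB; rewrite // eq_sym.
Qed.

(** The ones outside [J] let a row at position j collect all the mass of y except that on J \ {j},
    wherever else y spreads. *)
Definition block_game (R : realType) n (blk pos : 'I_n -> 'I_n)
    (J : {set 'I_n}) (t : 'I_n) : 'M[R]_n :=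
  bool_mx R n (fun i k =>
    [&& blk i == t, pos i \in J & (k == pos i) || (k \notin J)]).

(** Row [i0] earns [y j 0 + q >= 1 - delta * #|J|]. Rows of the block at another position in [J]
    earn at most [delta + (1 - y j 0)], hence [eps + delta]; those at position [j] are bounded by 1,
    and other rows earn 0. *)
Lemma block_game_regret (R : realType) n (blk pos : 'I_n -> 'I_n)
    (J : {set 'I_n}) (t j i0 : 'I_n) (x y : 'cV[R]_n) (delta eps : R) :
  mixed x -> mixed y -> j \in J -> blk i0 = t -> pos i0 = j -> 0 <= delta ->
  (forall k, k \in J -> k != j -> y k 0 <= delta) -> 1 <= y j 0 + eps ->
  payoff (unitv R i0) (block_game R n blk pos J t) y <=
    payoff x (block_game R n blk pos J t) y + eps ->
  1 <= delta *+ #|J| + (\sum_(i | blk i == t) x i 0) * (eps + delta) +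
       \sum_(i | (blk i == t) && (pos i == j)) x i 0 + eps.
Proof.
move=> mx my jJ bi0 pi0 delta0 ysmall yj.
pose q := \sum_(k | k \notin J) y k 0.
have [[x0 x1] [y0 y1]] := (mx, my).
have q0 : 0 <= q by apply: sumr_ge0.
have ysplit : 1 = y j 0 + \sum_(k in J | k != j) y k 0 + q.
  by rewrite -y1 (bigID (mem J)) /= (bigD1 j).
have rest0 : 0 <= \sum_(k in J | k != j) y k 0 by apply: sumr_ge0.
have rest : \sum_(k in J | k != j) y k 0 <= delta *+ #|J|.
  rewrite -sumr_const; apply: le_trans (_ : \sum_(k in J | k != j) delta <= _).
    by apply: ler_sum => k /andP[]; apply: ysmall.
  by apply: sum_subset_le => // k /andP[].
have rowE i : payoff (unitv R i) (block_game R n blk pos J t) y =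
    if (blk i == t) && (pos i \in J) then y (pos i) 0 + q else 0.
  rewrite payoff_bool_unitl; case: ifP => [/andP[-> piJ]|nS]; last first.
    by rewrite big_pred0 // => k; rewrite andbA nS.
  rewrite piJ /= (bigD1 (pos i)) ?eqxx //=; congr (_ + _).
  apply: eq_bigl => k; case: eqP => [->|_]; first by rewrite piJ.
  by rewrite andbT.
rewrite [payoff x _ _]payoffEl rowE bi0 eqxx pi0 jJ /= => reg.
have xle : \sum_i x i 0 * payoff (unitv R i) (block_game R n blk pos J t) y <=
    (\sum_(i | blk i == t) x i 0) * (eps + delta) +
       \sum_(i | (blk i == t) && (pos i == j)) x i 0.
  rewrite mulr_suml (big_mkcond (fun i => blk i == t)).
  rewrite [X in _ <= _ + X]big_mkcond -big_split /=; apply: ler_sum => i _.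
  rewrite rowE; have xi := x0 i.
  case: eqP => //= _; last by rewrite mulr0 addr0.
  case: (eqVneq (pos i) j) => [->|pij].
    by rewrite jJ -[X in _ <= _ + X]mulr1 -mulrDr; apply: ler_wpM2l => //; lra.
  rewrite addr0; case: ifP => piJ; apply: ler_wpM2l => //; last lra.
  by have := ysmall _ piJ pij; lra.
lra.
Qed.

(** Index t * d + j encodes block t and position j by quotient and remainder. The first d indices
    form [V] and label blocks and positions alike. *)
Lemma block_coordinates (d : nat) :
  exists (n : nat) (blk pos : 'I_n.+1 -> 'I_n.+1) (V : {set 'I_n.+1}),
    (d <= #|V|)%N /\
    {in V &, forall t j, exists2 i, blk i = t & pos i = j}.
Proof.
exists (d * d)%N, (fun i => inord (i %/ d)), (fun i => inord (i %% d)).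
have led : (d <= (d * d).+1)%N by nia.
exists [set widen_ord led i | i in 'I_d]; split.
  by rewrite card_imset ?card_ord // => i j /(congr1 val) ij; apply: val_inj.
move=> _ _ /imsetP[t _ ->] /imsetP[j _ ->].
have tjd : (t * d + j < (d * d).+1)%N by have := ltn_ord t; have := ltn_ord j; nia.
have d0 : (0 < d)%N by apply: leq_ltn_trans (ltn_ord t).
exists (Ordinal tjd); apply: val_inj; rewrite /= inordK /=.
- by rewrite divnMDl // divn_small ?addn0.
- by rewrite divnMDl // divn_small ?addn0 //; apply: leq_trans led.
- by rewrite modnMDl modn_small.
- by rewrite modnMDl modn_small //; apply: leq_trans led.
Qed.

(* Games have n.+1 >= 1 strategies per player (n ranges over all nat). *)
Theorem theorem2 (R : realType) (eps : R) (heps : eps < 501%:R / 1000%:R) :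
  ~ exists (fr : forall n : nat, 'M[R]_n.+1 -> 'cV[R]_n.+1)
           (fc : forall n : nat, 'M[R]_n.+1 -> 'cV[R]_n.+1),
      (forall n (Rm : 'M[R]_n.+1), unit_matrix Rm -> mixed (fr n Rm)) /\
      (forall n (C : 'M[R]_n.+1), unit_matrix C -> mixed (fc n C)) /\
      (forall n (Rm C : 'M[R]_n.+1), unit_matrix Rm -> unit_matrix C ->
         approx_NE Rm C (fr n Rm) (fc n C) eps).
Proof.
case=> fr [fc [mixr [mixc NE]]].
(* Keeping D abstract prevents the unary evaluation of the game size. *)
have [D eD] : exists D, D = 200%N by exists 200%N.
(* Large enough to extract a sparse 10-element set twice: the columns [J], and the blocks inside
   [block_mass_le]. *)
have [n [blk [pos [V [cV coord]]]]] := block_coordinates (10 * D.*2.+1).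
have D0 : (0 < D)%N by rewrite eD.
pose Cj j := bool_mx R n.+1 (fun _ k => k == j).
have uC j : unit_matrix (Cj j) by apply: unit_bool_mx.
pose y j := fc n (Cj j).
have my j : mixed (y j) by apply: mixc.
have [||J [JV cJ ysmall]] :=
  sparse_subset _ _ (fun j k => y j k 0) D 10 V D0 _ _ cV.
- by move=> j k; case: (my j).
- by move=> j; case: (my j) => _ ->.
pose Rt t := block_game R n.+1 blk pos J t.
have uR t : unit_matrix (Rt t) by apply: unit_bool_mx.
pose x t := fr n (Rt t).
have mx t : mixed (x t) by apply: mixr.
have yj j : 1 <= y j j 0 + eps.
  apply: (dominant_column_weight _ _ _ _ _ _ (mx j)).
  by case: (NE n _ _ (uR j) (uC j) j).
have [//||t tV xt] :=
  block_mass_le _ _ x (fc n) blk V 10 D eps _ D0 cV mx (mixc n).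
  by move=> C t j uC'; case: (NE n _ _ (uR t) uC' j).
pose B := \sum_(i | blk i == t) x t i 0.
(* [Rt t] does not depend on [j], so [j] can be chosen after [x t], among the 10 disjoint classes of
   rows by position. *)
have [||j jJ xj] := exists_le_average R _ J
  (fun j => \sum_(i | (blk i == t) && (pos i == j)) x t i 0) 10%:R^-1.
- by rewrite cJ.
- rewrite cJ -[leRHS]mulr_natr mulVf ?pnatr_eq0 //.
  rewrite (exchange_big_dep (fun i => blk i == t)) /=; last first.
    by move=> ? ? _ /andP[].
  apply: le_trans (mixed_le1 _ _ _ (fun i => blk i == t) (mx t)).
  apply: ler_sum => i it; have xi : 0 <= x t i 0 by case: (mx t).
  apply: (@le_trans _ _ (\sum_(k | k == pos i) x t i 0)).
    by apply: sum_subset_le => // k /and3P[_ _]; rewrite eq_sym.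
  by rewrite big_pred1_eq.
have [i0 bi0 pi0] := coord t j tV (subsetP JV j jJ).
have ysm k : k \in J -> k != j -> y j k 0 <= D%:R^-1.
  by move=> kJ kj; apply: ysmall; rewrite // eq_sym.
have delta0 : 0 <= D%:R^-1 :> R by rewrite invr_ge0 ler0n.
have reg := block_game_regret _ _ blk pos J t j i0 (x t) (y j) D%:R^-1 eps
  (mx t) (my j) jJ bi0 pi0 delta0 ysm (yj j) (NE n _ _ (uR t) (uC j) i0).1.
move: xt xj reg; rewrite -/B cJ eD => xt xj reg.
have B0 : 0 <= B by apply: sumr_ge0 => i _; case: (mx t).
(* This makes [reg] linear in [B]. As [B < 0.606], its right side is below 0.05 + 0.606 * 0.506 +
   0.1 + 0.501 < 1. *)
have : B * (eps + 200%:R^-1) <= B * (506%:R / 1000%:R).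
  by apply: ler_wpM2l => //; lra.
lra.
Qed.
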